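(* Let $(\underline F,\overline F)$ be a p-box on a totally preordered space $(\Omega,\preceq)$ with smallest element $0_\Omega$ and largest element $1_\Omega$, with $0$–$1$-valued $\overline F$, and let $C=\{x\in\Omega^*:\overline F(x)=0\}$ and $C^c=\Omega^*\setminus C$. Then, for any $A\subseteq\Omega$, $$\overline E_{\underline F,\overline F}(A)=\begin{cases}\displaystyle 1-\sup_{y\in\Omega^*:\,y\prec A\cap C^c}\underline F(y) & \text{if } A\cap C\preceq x\text{ for at least one }x\in C,\\ 1 & \text{otherwise,}\end{cases}$$ and also $$\overline E_{\underline F,\overline F}(A)=1-\max_{x\in C}\ \sup_{y\in\Omega^*:\,y\prec A\cap(x,1_\Omega]}\underline F(y)$$ (in particular the maximum over $x$ is attained).
   Context: A total preorder $\preceq$ is reflexive, transitive, with any two elements comparable; $x\prec y$ means $x\preceq y$ and not $y\preceq x$. A formal element $0_\Omega-$ is added: $\Omega^*=\Omega\cup\{0_\Omega-\}$ with $0_\Omega-\prec x$ for all $x\in\Omega$. For a set $S$, $S\preceq x$ means $z\preceq x$ for all $z\in S$, and $y\prec S$ means $y\prec z$ for all $z\in S$ (both hold vacuously for $S=\emptyset$). $(x,1_\Omega]=\{z\in\Omega:x\prec z\}$ and $[0_\Omega,x]=\{z\in\Omega:z\preceq x\}$. A cumulative distribution function is a non-decreasing map $F:\Omega\to[0,1]$ with $F(1_\Omega)=1$, extended to $\Omega^*$ by $F(0_\Omega-)=0$. A p-box is a pair $(\underline F,\overline F)$ of cumulative distribution functions with $\underline F\le\overline F$. $F$ is $0$–$1$-valued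 if it takes only the values $0$ and $1$. The natural extension of the p-box is $\overline E_{\underline F,\overline F}(A)=\sup P(A)$ for $A\subseteq\Omega$, the supremum being over all finitely additive probabilities $P$ on the power set of $\Omega$ with $\underline F(x)\le P([0_\Omega,x])\le\overline F(x)$ for all $x\in\Omega$. *)

(* Defs.v *)
From HB Require Import structures.
From mathcomp Require Import all_boot all_order all_algebra.
From mathcomp Require Import boolp classical_sets reals ereal.
From mathcomp Require Import constructive_ereal.
From mathcomp Require Import measurable_structure measure_function.

Set Implicit Arguments.
Unset Strict Implicit.
Unset Printing Implicit Defensive.
Import Order.TTheory GRing.Theory Num.Theory.

Local Open Scope classical_set_scope.
Local Open Scope ring_scope.

(* [adjoin_bot T] is T together with a new element [None] (the formal 0-) placed
   strictly below every [Some x]. Its strict order [x < y] is by construction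
   [(x <= y) && ~~ (y <= x)]. *)
Definition adjoin_bot (T : Type) := option T.

HB.instance Definition _ (T : choiceType) :=
  Choice.copy (adjoin_bot T) (option T).

Definition adjoin_bot_le d (T : preorderType d) : rel (adjoin_bot T) :=
  fun x y => match x, y with
  | None, _ => true
  | Some _, None => false
  | Some a, Some b => (a <= b)%O
  end.

Lemma adjoin_bot_le_refl d (T : preorderType d) :
  reflexive (@adjoin_bot_le d T).
Proof. by case=> [a|] //=; exact: Order.PreorderTheory.lexx. Qed.

Lemma adjoin_bot_le_trans d (T : preorderType d) :
  transitive (@adjoin_bot_le d T).
Proof.
by case=> [b|] [a|] [c|] //=; exact: Order.PreorderTheory.le_trans.
Qed.

HB.instance Definition _ d (T : preorderType d) :=
  Order.Le_isPreorder.Build d (adjoin_bot T)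
    (@adjoin_bot_le_refl d T) (@adjoin_bot_le_trans d T).

Definition set_le d (T : preorderType d) (S : set T) (x : adjoin_bot T) : Prop :=
  forall z, S z -> ((Some z : adjoin_bot T) <= x)%O.

Definition lt_set d (T : preorderType d) (y : adjoin_bot T) (S : set T) : Prop :=
  forall z, S z -> (y < (Some z : adjoin_bot T))%O.

Definition up_strict d (T : preorderType d) (x : adjoin_bot T) : set T :=
  [set z | (x < (Some z : adjoin_bot T))%O].

Definition down d (T : preorderType d) (x : T) : set T := [set z | (z <= x)%O].

Definition is_cdf (R : realType) d (T : tbPreorderType d) (F : T -> R) : Prop :=
  [/\ forall x y : T, (x <= y)%O -> F x <= F y,
      forall x, 0 <= F x <= 1
    & F \top%O = 1].

Definition cdf_ext (R : realType) (T : Type) (F : T -> R) (y : adjoin_bot T) : R :=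
  if y is Some x then F x else 0.

Definition is_pbox (R : realType) d (T : tbPreorderType d) (lF uF : T -> R) : Prop :=
  [/\ is_cdf lF, is_cdf uF & forall x, lF x <= uF x].

(* T equipped with the algebra of all its subsets, so that a content on
   [powerset_space T] is a finitely additive measure on the power set of T.
   The base point required by the hierarchy is irrelevant. *)
Definition powerset_space (T : Type) := T.

HB.instance Definition _ d (T : tbPreorderType d) :=
  Choice.copy (powerset_space T) T.

HB.instance Definition _ d (T : tbPreorderType d) :=
  isPointed.Build (powerset_space T) (\bot%O : T).

HB.instance Definition _ d (T : tbPreorderType d) :=
  @isMeasurable.Build default_measure_display (powerset_space T)
    discrete_measurable discrete_measurable0
    discrete_measurableC discrete_measurableU.

Definition credal_set (R : realType) d (T : tbPreorderType d) (lF uF : T -> R) :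
    set {content set (powerset_space T) -> \bar R} :=
  [set P | P setT = 1%E /\
     forall x : T, ((lF x)%:E <= P (down x) <= (uF x)%:E)%E].

Definition natural_ext (R : realType) d (T : tbPreorderType d)
    (lF uF : T -> R) (A : set T) : \bar R :=
  ereal_sup [set P A | P in credal_set lF uF].

(* [None] always satisfies [lt_set None S], so the supremum is over a nonempty
   set. *)
Definition sup_below (R : realType) d (T : tbPreorderType d) (F : T -> R)
    (S : set T) : R :=
  sup [set cdf_ext F y | y in [set y : adjoin_bot T | lt_set y S]].

(* Main.v *)
(* Every feasible P vanishes on [0, x] for x in C, and P([0, y]) >= lF y for y
   strictly below S = { z in A : x < z }, so P(A) = P(S) <= 1 - lF y. For the
   converse, ultrafilters serve as 0-1-valued finitely additive probabilities.
   If A meets C cofinally, an ultrafilter concentrated on A just below the upper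
   end of C is feasible and gives A mass 1. Otherwise, with s the supremum of lF
   below A \ C, put mass 1 - s on an ultrafilter concentrated on A at the lower
   end of A \ C, and mass s on one sitting at the cut between C and its
   complement. *)
From HB Require Import structures.
Require Import Defs.
From mathcomp Require Import all_boot all_order all_algebra.
From mathcomp Require Import boolp classical_sets reals ereal.
From mathcomp Require Import constructive_ereal.
From mathcomp Require Import measurable_structure measure_function.
From mathcomp Require Import filter lra.

Set Implicit Arguments.
Unset Strict Implicit.
Unset Printing Implicit Defensive.
Import Order.TTheory GRing.Theory Num.Theory.

Local Open Scope classical_set_scope.
Local Open Scope ring_scope.

(** * Ultrafilters as finitely additive probabilities *)

Section UltrafilterMixture.
Variables (R : realType) (d : Order.disp_t) (T : tbPreorderType d).
Variables F G : set_system T.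
Hypotheses (FU : UltraFilter F) (GU : UltraFilter G).

(** If [H] contains [B], properness keeps the disjoint set [D] out. Otherwise [H] contains the
    complement of [B], and intersecting with it reduces the union to [D]. *)
Lemma ultrafilter_indicU (H : set_system T) (B D : set T) : UltraFilter H ->
  B `&` D = set0 ->
  `[< H (B `|` D) >]%:R = `[< H B >]%:R + `[< H D >]%:R :> R.
Proof.
move=> HU BD0.
have [HB|nHB] := asboolP (H B).
  have -> : `[< H (B `|` D) >] = true.
    by apply/asboolP; apply: filterS HB; left.
  have -> : `[< H D >] = false.
    apply/asboolP => HD; apply: (@filter_not_empty _ H).
    by rewrite -BD0; exact: filterI.
  by rewrite addr0.
rewrite add0r; congr (nat_of_bool _)%:R; apply/asbool_equiv_eq; split.
  move=> HBD; have [//|HnB] := in_ultra_setVsetC B HU.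
  by apply: filterS (filterI HBD HnB) => z [[]].
by move=> HD; apply: filterS HD; right.
Qed.

Definition ultrafilter_mixture (s : R) (B : set (powerset_space T)) : \bar R :=
  ((1 - s) * `[< F B >]%:R + s * `[< G B >]%:R)%:E.

Lemma ultrafilter_mixture_content (s : R) : 0 <= s <= 1 ->
  exists P : {content set (powerset_space T) -> \bar R},
    P = ultrafilter_mixture s :> (set T -> \bar R).
Proof.
move=> /andP[s0 s1].
have ge0 B : (0 <= ultrafilter_mixture s B)%E.
  by rewrite lee_fin addr_ge0// mulr_ge0// subr_ge0.
have mix0 : ultrafilter_mixture s set0 = 0%E.
  rewrite /ultrafilter_mixture.
  have -> : `[< F set0 >] = false by apply/asboolP; exact: filter_not_empty.
  have -> : `[< G set0 >] = false by apply/asboolP; exact: filter_not_empty.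
  by rewrite !mulr0 addr0.
have add : measure_function.semi_additive (ultrafilter_mixture s).
  apply/(additive2P mix0) => B D _ _ BD0.
  rewrite /ultrafilter_mixture -EFinD !ultrafilter_indicU//.
  by congr EFin; lra.
pose mixin := isContent.Build _ _ _ (ultrafilter_mixture s) ge0 add.
pose P : {content set (powerset_space T) -> \bar R} :=
  HB.pack (ultrafilter_mixture s) mixin.
by exists P.
Qed.

End UltrafilterMixture.

(** * Ultrafilters at cuts, and bounds on the natural extension *)

Section NaturalExtension.
Variables (R : realType) (d : Order.disp_t) (T : tbPreorderType d).
Hypothesis Ttotal : total (@Order.le d T).
Implicit Types (a x y : adjoin_bot T) (S A : set T) (lF uF : T -> R).

Lemma adjoin_bot_total : total (@Order.le d (adjoin_bot T)).
Proof. by case=> [a|] [b|] //=; exact: Ttotal. Qed.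

Lemma adjoin_bot_leNlt a (b : adjoin_bot T) : ~ (a < b)%O -> (b <= a)%O.
Proof.
move=> nab; have [ab|//] := orP (adjoin_bot_total a b).
by apply/negPn/negP => nba; apply: nab; rewrite lt_leAnge ab nba.
Qed.

(** At [None] this is the empty set, matching the value 0 of [cdf_ext] there, so that the p-box
    constraints hold on all of [adjoin_bot T]. *)
Definition down_ext a : set T := [set z | ((Some z : adjoin_bot T) <= a)%O].

Lemma down_extC a : ~` down_ext a = up_strict a.
Proof.
apply/seteqP; split => z /=; last first.
  by rewrite /up_strict/= lt_leAnge => /andP[_ /negP].
move=> /negP nza; rewrite /up_strict/= lt_leAnge nza andbT.
by apply: adjoin_bot_leNlt => /ltW /(negP nza).
Qed.

(* Every set of the base [S `&` ]a, b]], for [a] in the lower part [L] and [b]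
   above it, is nonempty, so some ultrafilter refines it: it behaves as a unit
   mass in [S] located at the cut determined by [L]. *)
Lemma cut_ultrafilter (L : set (adjoin_bot T)) S :
  L None -> ~ L (Some \top%O) ->
  (forall a (b : T), L a -> ~ L (Some b) ->
    exists z, [/\ S z, (a < (Some z : adjoin_bot T))%O & (z <= b)%O]) ->
  exists G : set_system T, [/\ UltraFilter G, G S,
    forall a, L a -> ~ G (down_ext a)
    & forall b : T, ~ L (Some b) -> G (Defs.down b)].
Proof.
move=> LN nLt SL.
pose D := [set ab : adjoin_bot T * T | L ab.1 /\ ~ L (Some ab.2)].
pose B (ab : adjoin_bot T * T) := S `&` up_strict ab.1 `&` Defs.down ab.2.
have Bfilter : Filter (filter_from D B).
  apply: filter_from_filter; first by exists (None, \top%O).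
  move=> [a b] [a' b'] [/= La Lb] [/= La' Lb'].
  (* Totality makes the base directed: the larger lower end and the smaller upper end give a set
     inside both. *)
  have [a2 [La2 aa2 a'a2]] : exists a2, [/\ L a2, (a <= a2)%O & (a' <= a2)%O].
    by have /orP[] := adjoin_bot_total a a'; [exists a'|exists a].
  have [b2 [Lb2 bb2 b'b2]] :
      exists b2, [/\ ~ L (Some b2), (b2 <= b)%O & (b2 <= b')%O].
    by have /orP[] := Ttotal b b'; [exists b|exists b'].
  exists (a2, b2) => // z [[/= Sz az] zb].
  split; split; [|exact: le_trans zb _| |exact: le_trans zb _];
    by split=> //; exact: le_lt_trans az.
have Bproper : ProperFilter (filter_from D B).
  apply: filter_from_proper => -[a b] [/= La Lb].
  by have [z [Sz az zb]] := SL a b La Lb; exists z.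
have [G [GU BG]] := ultraFilterLemma Bproper.
have GB ab : D ab -> G (B ab) by move=> Dab; apply: BG; exists ab.
exists G; split=> //.
- have : G (B (None, \top%O)) by exact: GB.
  by apply: filterS => z [[]].
- move=> a La Ga; have Gat : G (B (a, \top%O)) by exact: GB.
  apply: (@filter_not_empty _ G); apply: filterS (filterI Ga Gat) => z [za].
  by move=> [[_]] /[swap] _; rewrite /up_strict/= lt_leAnge => /andP[_ /negP].
- move=> b Lb; have : G (B (None, b)) by exact: GB.
  by apply: filterS => z [].
Qed.

Lemma has_sup_below lF S : is_cdf lF ->
  has_sup [set cdf_ext lF y | y in [set y : adjoin_bot T | lt_set y S]].
Proof.
move=> [_ lF01 _]; split; first by exists 0, None.
by exists 1 => _ [[y|] _ <-] //=; have /andP[] := lF01 y.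
Qed.

Lemma sup_below_ge lF S y : is_cdf lF -> lt_set y S ->
  cdf_ext lF y <= sup_below lF S.
Proof.
by move=> cdf yS; apply: (sup_upper_bound (has_sup_below S cdf)); exists y.
Qed.

Lemma sup_below_le lF S c :
  (forall y, lt_set y S -> cdf_ext lF y <= c) -> sup_below lF S <= c.
Proof.
move=> h; apply: ge_sup; first by exists 0, None.
by move=> _ [y yS <-]; exact: h.
Qed.

Lemma sup_below_itv lF S : is_cdf lF -> 0 <= sup_below lF S <= 1.
Proof.
move=> cdf; have [_ lF01 _] := cdf.
rewrite (@sup_below_ge lF S None)//=.
by apply: sup_below_le => -[y|] _ //=; have /andP[] := lF01 y.
Qed.

Lemma sup_belowS lF S S' : is_cdf lF -> S `<=` S' ->
  sup_below lF S' <= sup_below lF S.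
Proof.
move=> cdf SS'; apply: sup_below_le => y yS'.
by apply: sup_below_ge => // z /SS'; exact: yS'.
Qed.

Lemma credal_down_ext lF uF (P : {content set (powerset_space T) -> \bar R}) a :
  credal_set lF uF P ->
  ((cdf_ext lF a)%:E <= P (down_ext a) <= (cdf_ext uF a)%:E)%E.
Proof.
move=> [_ PF]; case: a => [a|]; first exact: PF.
have -> : down_ext None = set0 by apply/seteqP; split.
by rewrite measure0 lexx.
Qed.

Lemma credal_le lF uF (P : {content set (powerset_space T) -> \bar R}) A x y :
  credal_set lF uF P -> cdf_ext uF x = 0 ->
  lt_set y (A `&` up_strict x) -> (P A <= (1 - cdf_ext lF y)%:E)%E.
Proof.
move=> PC x0 yA.
have mP (B : set (powerset_space T)) : measurable B by [].
have Px : P (down_ext x) = 0%E.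
  by apply/eqP; rewrite -measure_le0 -[leRHS]/(0%:E) -x0;
    have /andP[] := credal_down_ext x PC.
have PAx : P A = P (A `&` up_strict x).
  have {1}-> : A = (A `&` down_ext x) `|` (A `&` up_strict x).
    by rewrite -setIUr -down_extC setUv setIT.
  rewrite measureU//; last by rewrite -down_extC setIACA setICr setI0.
  have -> : P (A `&` down_ext x) = 0%E.
    by apply/eqP; rewrite -measure_le0 -Px le_measure ?inE.
  by rewrite add0e.
rewrite EFinB leeBrDr// -PC.1 PAx.
have /andP[lFy _] := credal_down_ext y PC.
apply: (le_trans (leeD2l _ lFy)); rewrite -measureU//.
  by rewrite le_measure ?inE.
by rewrite -subset0 => z [/yA + zy]; rewrite lt_leAnge => /andP[_ /negP].
Qed.

Lemma natural_ext_le lF uF A x : is_cdf lF -> cdf_ext uF x = 0 ->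
  (natural_ext lF uF A <= (1 - sup_below lF (A `&` up_strict x))%:E)%E.
Proof.
move=> cdf x0; apply: ge_ereal_sup => _ [P PC <-].
(* Taking [y] to be [None] bounds [P A] by 1, which excludes an infinite value and allows arguing in
   the reals. *)
have := credal_le (A := A) PC x0; have := measure_ge0 P A.
case: (P A) => [p| |] // _ PA; last by have := PA None (fun _ _ => erefl).
rewrite lee_fin lerBrDr addrC -lerBrDr; apply: sup_below_le => y yA.
by have := PA _ yA; rewrite lee_fin; lra.
Qed.

(** The hypotheses make the mixture with weights [1 - s] and [s] feasible. Where [uF] is 0, neither
    ultrafilter charges the down-set. Where [uF] is 1, only the lower bound matters: [G] already
    contributes [s], which suffices unless [F] also contains the down-set, and then the mass is 1.
    The mass [G] may give to [A] is dropped. *)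
Lemma natural_ext_ge lF uF A (F G : set_system T) s : is_pbox lF uF ->
  (forall x : T, uF x = 0 \/ uF x = 1) ->
  UltraFilter F -> UltraFilter G -> 0 <= s <= 1 ->
  (forall b : T, uF b = 0 -> ~ F (Defs.down b)) ->
  (forall b : T, uF b = 0 -> ~ G (Defs.down b)) ->
  (forall b : T, uF b <> 0 -> G (Defs.down b)) ->
  (forall b : T, ~ F (Defs.down b) -> lF b <= s) ->
  (((1 - s) * `[< F A >]%:R)%:E <= natural_ext lF uF A)%E.
Proof.
move=> [[_ lF01 _] _ lu] uF01 FU GU s01 F0 G0 G1 Fs.
have [P PE] := ultrafilter_mixture_content FU GU s01.
have /andP[s0 s1] := s01.
apply: (@le_trans _ _ (P A)).
  by rewrite PE lee_fin lerDl mulr_ge0.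
apply: ereal_sup_ubound; exists P => //; split=> [|x].
  rewrite PE /ultrafilter_mixture.
  have -> : `[< F setT >] by apply/asboolP; exact: filterT.
  have -> : `[< G setT >] by apply/asboolP; exact: filterT.
  by rewrite !mulr1 subrK.
rewrite PE !lee_fin; have [ux0|ux1] := uF01 x.
  have -> : `[< F (Defs.down x) >] = false by apply/asboolP; exact: F0.
  have -> : `[< G (Defs.down x) >] = false by apply/asboolP; exact: G0.
  by have := lu x; rewrite ux0 !mulr0 addr0 => ->/=.
have -> : `[< G (Defs.down x) >].
  by apply/asboolP/G1; rewrite ux1; apply/eqP; exact: oner_neq0.
have /andP[_ lx1] := lF01 x.
have [Fx|/Fs lxs] := asboolP (F (Defs.down x)); apply/andP; split=> /=; lra.
Qed.

End NaturalExtension.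

Theorem proposition10 (R : realType) (d : Order.disp_t) (T : tbPreorderType d)
    (Ttotal : total (@Order.le d T)) (lF uF : T -> R)
    (pbox : is_pbox lF uF) (uF01 : forall x, uF x = 0 \/ uF x = 1) (A : set T) :
  let C : set (adjoin_bot T) := [set x | cdf_ext uF x = 0] in
  let AC : set T := A `&` Some @^-1` C in
  let ACc : set T := A `&` Some @^-1` (~` C) in
  natural_ext lF uF A =
    (if `[< exists2 x, C x & set_le AC x >]
     then (1 - sup_below lF ACc)%:E else 1%E)
  /\
  exists m : R,
    [/\ [set sup_below lF (A `&` up_strict x) | x in C] m,
        ubound [set sup_below lF (A `&` up_strict x) | x in C] m
      & natural_ext lF uF A = (1 - m)%:E].
Proof.
move=> C AC ACc; have [lcdf [uhomo _ utop] lu] := pbox.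
have [_ lF01 ltop] := lcdf.
have CN : C None by [].
have nCt : ~ C (Some \top%O) by rewrite /C/= utop; apply/eqP; exact: oner_neq0.
(* [C] is an initial segment, since [uF] is monotone. *)
have Clt a b : C a -> ~ C b -> (a < b)%O.
  move=> Ca nCb; apply/negPn/negP => /negP /(adjoin_bot_leNlt Ttotal).
  move: Ca nCb; rewrite /C/=; case: a b => [a|] [b|] //=.
  move=> ua0 ub /uhomo; rewrite ua0 => ub0.
  by have [//|ub1] := uF01 b; move: ub0; rewrite ub1 ler10.
have lC a : C a -> cdf_ext lF a = 0.
  rewrite /C/=; case: a => [a|] //= ua0; apply/eqP; rewrite eq_le -{1}ua0 lu.
  by have /andP[] := lF01 a.
have [|G [GU _ GC GnC]] := @cut_ultrafilter _ _ Ttotal C setT CN nCt.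
  by move=> a b Ca nCb; exists b; split=> //; exact: Clt.
have [[x Cx ACx]|unbdd] := asboolP (exists2 x, C x & set_le AC x).
  have Aup : A `&` up_strict x = ACc.
    apply/seteqP; split=> z [Az]; last by move=> nCz; split=> //; exact: Clt.
    rewrite /up_strict/= lt_leAnge => /andP[_ /negP nzx].
    by split=> // Cz; apply: nzx; exact: ACx.
  have s01 := sup_below_itv ACc lcdf.
  have natE : natural_ext lF uF A = (1 - sup_below lF ACc)%:E.
    apply/eqP; rewrite eq_le -{1}Aup natural_ext_le//=.
    (* If [ACc] is empty, even the top lies vacuously below it, so the supremum is 1 and the value
       to reach is 0: any feasible content will do, here [G] alone. *)
    have [ACc0|/set0P[z0 ACz0]] := eqVneq ACc set0.
      have -> : sup_below lF ACc = 1.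
        apply/eqP; rewrite eq_le; have /andP[_ ->] := s01.
        rewrite -ltop.
        apply: (@sup_below_ge _ _ _ lF ACc (Some \top%O)) => // z.
        by rewrite ACc0.
      have := @natural_ext_ge _ _ _ lF uF A G G 1 pbox uF01 GU GU.
      rewrite subrr mul0r; apply.
      - by rewrite ler01 lexx.
      - by move=> b b0; exact: (GC (Some b)).
      - by move=> b b0; exact: (GC (Some b)).
      - by move=> b nb; exact: GnC.
      - by move=> b _; have /andP[] := lF01 b.
    (* The cut at the lower end of [ACc]. Its lower part includes [C], so [F] respects the
       constraints where [uF] is 0. If [F] omits the down-set of [b], then [b] is in [L] and [lF b]
       is at most the supremum. *)
    pose L := [set y : adjoin_bot T | lt_set y ACc].
    have nLt : ~ L (Some \top%O).
      move=> /(_ _ ACz0); rewrite lt_leAnge => /andP[_].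
      by rewrite [(_ <= _)%O]lex1.
    have [//||F [FU FA FL FnL]] := @cut_ultrafilter _ _ Ttotal L A _ nLt.
      move=> a b La nLb; have [z ACz nbz] :
          exists2 z, ACc z & ~ ((Some b : adjoin_bot T) < Some z)%O.
        apply: contrapT => nz; apply: nLb => z ACz; apply: contrapT => nbz.
        by apply: nz; exists z.
      exists z; split; [by case: ACz | exact: La |].
      exact: (adjoin_bot_leNlt Ttotal nbz).
    have FA1 : `[< F A >] by apply/asboolP.
    have := @natural_ext_ge _ _ _ lF uF A F G _ pbox uF01 FU GU s01.
    rewrite FA1 mulr1; apply=> //.
    - move=> b b0; apply: (FL (Some b)) => z [_ nCz]; exact: Clt.
    - by move=> b b0; exact: (GC (Some b)).
    - move=> b nFb; apply: (@sup_below_ge _ _ _ lF ACc (Some b)) => //.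
      by apply: contrapT => /FnL.
  split=> //; exists (sup_below lF ACc); split=> //.
    by exists x => //; rewrite Aup.
  (* Any other point of [C] leaves a larger part of [A] above it, hence a smaller supremum. *)
  move=> _ [x' Cx' <-]; apply: sup_belowS => // z [Az nCz]; split=> //.
  exact: Clt.
have Aunb a : C a -> exists2 z, A z & C (Some z) /\ (a < Some z)%O.
  move=> Ca; apply: contrapT => na; apply: unbdd; exists a => // z [Az Cz].
  by apply: (adjoin_bot_leNlt Ttotal) => az; apply: na; exists z.
have natE : natural_ext lF uF A = 1%E.
  apply/eqP; rewrite eq_le; apply/andP; split.
    apply: (le_trans (natural_ext_le Ttotal (x := None) A lcdf CN)).
    rewrite lee_fin lerBlDr lerDl.
    by have /andP[] := sup_below_itv (A `&` up_strict None) lcdf.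
  (* The cut is that of [C], but now concentrated on [A]. Weight [s = 0] is allowed because a
     down-set omitted by [F] ends in [C], where [lF] vanishes. *)
  have [|F [FU FA FC FnC]] := @cut_ultrafilter _ _ Ttotal C A CN nCt.
    move=> a b Ca nCb; have [z Az [Cz az]] := Aunb a Ca.
    exists z; split=> //; exact: (ltW (Clt _ _ Cz nCb)).
  have FA1 : `[< F A >] by apply/asboolP.
  have := @natural_ext_ge _ _ _ lF uF A F F 0 pbox uF01 FU FU.
  rewrite FA1 subr0 mulr1; apply.
  - by rewrite lexx ler01.
  - by move=> b b0; exact: (FC (Some b)).
  - by move=> b b0; exact: (FC (Some b)).
  - by move=> b nb; exact: FnC.
  - move=> b nFb; rewrite -[lF b]/(cdf_ext lF (Some b)) lC//.
    by apply: contrapT => /FnC.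
(* Some point of [A] above [x] is still in [C], so every competing [y] lies in [C], where [lF] is 0.
   All the suprema are therefore 0. *)
have sup0 x : C x -> sup_below lF (A `&` up_strict x) = 0.
  move=> Cx; apply/eqP; rewrite eq_le.
  have /andP[-> _] := sup_below_itv (A `&` up_strict x) lcdf; rewrite andbT.
  apply: sup_below_le => y yA.
  have [z Az [Cz xz]] := Aunb x Cx.
  have yz := yA z (conj Az xz); rewrite lC//.
  apply: contrapT => nCy; have := lt_trans (Clt _ _ Cz nCy) yz.
  by rewrite ltxx.
split=> //; exists 0; split; last by rewrite subr0.
  by exists None => //; exact: sup0.
by move=> _ [x Cx <-]; rewrite sup0.
Qed.
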